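(* Let $S,Q\in\mathbb{C}^{\nu\times\nu}$, $L\in\mathbb{C}^{p\times\nu}$, $R\in\mathbb{C}^{\nu\times q}$ with $(L,S)$ observable, $(Q,R)$ controllable, $\sigma(S)\cap\Omega=\emptyset$ and $\sigma(Q)\cap\Omega=\emptyset$. Let $\Pi\in\mathbb{C}^{n\times\nu}$ and $\Upsilon\in\mathbb{C}^{\nu\times n}$ be the solutions of $$M\Pi S^2+D\Pi S+K\Pi=BL,\qquad Q^2\Upsilon M+Q\Upsilon D+\Upsilon K=RC_0+QRC_1,$$ and suppose $T:=\Upsilon\Pi$ is nonsingular. Let $\widehat W(s)=(H_1s+H_0)(F_2s^2+F_1s+F_0)^{-1}G$ be the transfer matrix of the projected reduced model $$F_2=T^{-1}\Upsilon M\Pi,\quad F_1=T^{-1}\Upsilon D\Pi,\quad F_0=T^{-1}\Upsilon K\Pi,\quad G=T^{-1}\Upsilon B,\quad H_1=C_1\Pi,\quad H_0=C_0\Pi.$$ Suppose that a simple point $s_i$ belongs to both $\sigma(S)$ and $\sigma(Q)$, with $Sv_i=s_iv_i$ and $w_i^\ast Q=s_iw_i^\ast$, and let $\ell_i=Lv_i$ and $\rho_i^\ast=w_i^\ast R$. If $s_i$ is not a pole of the reduced model, then $$\widehat W(s_i)\ell_i=W(s_i)\ell_i,\qquad \rho_i^\ast\widehat W(s_i)=\rho_i^\ast W(s_i),\qquad \rho_i^\ast\widehat W'(s_i)\ell_i=\rho_i^\ast W'(s_i)\ell_i.$$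
   Context: The system is the second-order system with $p$ inputs and $q$ outputs $M\ddot x+D\dot x+Kx=Bu$, $y=C_1\dot x+C_0x$, with $M,D,K\in\mathbb{R}^{n\times n}$, $B\in\mathbb{R}^{n\times p}$, $C_0,C_1\in\mathbb{R}^{q\times n}$, transfer matrix $W(s)=(C_1s+C_0)(Ms^2+Ds+K)^{-1}B$, and $\Omega=\{s\in\mathbb{C}:\det(Ms^2+Ds+K)=0\}$. ''Simple point'' means that $s_i$ is a simple eigenvalue of both $S$ and $Q$; $v_i,w_i\in\mathbb{C}^\nu$ are nonzero; $\ast$ denotes conjugate transpose. The poles of the reduced model are the $s\in\mathbb{C}$ with $\det(F_2s^2+F_1s+F_0)=0$. *)

(* Defs.v *)
From HB Require Import structures.
From mathcomp Require Import all_boot all_order all_algebra.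
From mathcomp Require Import all_classical all_reals all_analysis.
From mathcomp Require Import complex.

Set Implicit Arguments.
Unset Strict Implicit.
Unset Printing Implicit Defensive.

Import Order.TTheory GRing.Theory Num.Theory.
Import numFieldNormedType.Exports.

Local Open Scope ring_scope.
Local Open Scope complex_scope.

Section SecondOrder.
Variable F : fieldType.

Definition pencil n (M D K : 'M[F]_n) (s : F) : 'M[F]_n :=
  s ^+ 2 *: M + s *: D + K.

(* Finite eigenvalues of the pencil. For the system itself this is Omega,
   for the reduced model it is the set of poles. *)
Definition is_pencil_root n (M D K : 'M[F]_n) (s : F) : Prop :=
  \det (pencil M D K s) = 0.

(* Meaningful away from the roots of the pencil: invmx fixes singular matrices. *)
Definition transfer n p q (M D K : 'M[F]_n) (B : 'M[F]_(n, p))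
    (C1 C0 : 'M[F]_(q, n)) (s : F) : 'M[F]_(q, p) :=
  (s *: C1 + C0) *m invmx (pencil M D K s) *m B.

(* Kalman rank conditions. The powers are ring powers in 'M_nu, so A ^+ 0 is
   the identity for every nu. *)
Definition controllable nu q (A : 'M[F]_nu) (B : 'M[F]_(nu, q)) : Prop :=
  \rank (\mxrow_(k < nu) ((A ^+ k) *m B)) = nu.

Definition observable nu p (C : 'M[F]_(p, nu)) (A : 'M[F]_nu) : Prop :=
  \rank (\mxcol_(k < nu) (C *m (A ^+ k))) = nu.

Definition simple_eigenvalue nu (A : 'M[F]_nu) (s : F) : Prop :=
  mup s (char_poly A) = 1%N.

End SecondOrder.

Section ComplexMatrices.
Variable R : realType.

Definition complexify m n (A : 'M[R]_(m, n)) : 'M[R[i]]_(m, n) :=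
  map_mx (real_complex R) A.

(* Entrywise complex derivative: derive1 is taken over the field R[i]. *)
Definition mxderiv m n (W : R[i] -> 'M[R[i]]_(m, n)) (s : R[i]) :
    'M[R[i]]_(m, n) :=
  \matrix_(i, j) derive1 (fun z : R[i] => (W z i j : R[i]^o)) s.

End ComplexMatrices.

(* Main.v *)
(* Let P be the pencil of the system, F that of the reduced model and
   C(s) = s C1 + C0. Evaluating the two Sylvester equations on the eigenvectors
   gives P(si) (Pi vi) = B li and (wi^* Ups) P(si) = rhoi^* C(si). Since
   F(s) = T^-1 Ups P(s) Pi, the reduced model satisfies the same equations with
   state vi and costate wi^* T: F(si) vi = G li and
   (wi^* T) F(si) = rhoi^* C(si) Pi. Hence both transfer matrices have the same
   tangential values C(si) Pi vi and wi^* Ups B. As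
   W' = C1 P^-1 B - C P^-1 P' P^-1 B, both bitangential derivatives equal
   rhoi^* C1 Pi vi - wi^* Ups P'(si) Pi vi. *)
Require Import Defs.
From HB Require Import structures.
From mathcomp Require Import all_boot all_order all_algebra.
From mathcomp Require Import perm.
From mathcomp Require Import all_classical all_reals all_analysis.
From mathcomp Require Import complex.

Set Implicit Arguments.
Unset Strict Implicit.
Unset Printing Implicit Defensive.

Import Order.TTheory GRing.Theory Num.Theory.
Import numFieldNormedType.Exports.

Local Open Scope ring_scope.
Local Open Scope complex_scope.
Local Open Scope sesquilinear_scope.

Section MatrixDerivative.
Variable F : numFieldType.

(** Entrywise, so that the scalar rules apply directly. Unlike [mxderiv], it records
    differentiability together with the value; [F^o] regards the field as a normed module over
    itself. *)
Definition is_mxderive m n (W : F -> 'M[F]_(m, n)) (s : F) (dW : 'M[F]_(m, n)) :=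
  forall i j, is_derive s 1 (fun z : F => (W z i j : F^o)) (dW i j).

Lemma is_mxderive_eq m n (W : F -> 'M[F]_(m, n)) s dW dW' :
  is_mxderive W s dW -> dW = dW' -> is_mxderive W s dW'.
Proof. by move=> ? <-. Qed.

Lemma is_mxderive_cst m n (A : 'M[F]_(m, n)) s : is_mxderive (fun=> A) s 0.
Proof. by move=> i j; rewrite mxE; exact: is_derive_cst. Qed.

Lemma is_mxderiveD m n (U V : F -> 'M[F]_(m, n)) s dU dV :
  is_mxderive U s dU -> is_mxderive V s dV ->
  is_mxderive (fun z => U z + V z) s (dU + dV).
Proof.
move=> dUs dVs i j; rewrite mxE.
rewrite (_ : (fun z => _) = (fun z => U z i j : F^o) + (fun z => V z i j : F^o)).
  exact: is_deriveD.
by apply/funext => z; rewrite mxE.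
Qed.

Lemma is_mxderive_scale m n (f : F -> F^o) (A : 'M[F]_(m, n)) (s : F) (df : F^o) :
  is_derive s 1 f df -> is_mxderive (fun z => f z *: A) s (df *: A).
Proof.
move=> dfs i j.
rewrite (_ : (fun z => _) = A i j *: f); last first.
  by apply/funext => z; rewrite mxE mulrC.
by apply: is_derive_eq; rewrite mxE mulrC.
Qed.

Lemma is_mxderiveM m n p (U : F -> 'M[F]_(m, n)) (V : F -> 'M[F]_(n, p)) s
    dU dV :
  is_mxderive U s dU -> is_mxderive V s dV ->
  is_mxderive (fun z => U z *m V z) s (dU *m V s + U s *m dV).
Proof.
move=> dUs dVs i j.
rewrite (_ : (fun z => _) =
    \sum_k ((fun z => U z i k : F^o) * (fun z => V z k j : F^o))); last first.
  by apply/funext => z; rewrite mxE fct_sumE.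
apply: (is_derive_eq (is_derive_sum (fun k => is_deriveM (dUs i k) (dVs k j)))).
rewrite !mxE -big_split; apply: eq_bigr => k _.
by rewrite addrC /= [V s k j *: _]mulrC.
Qed.

(** By the Leibniz formula the determinant is a polynomial in the entries. *)
Lemma derivable_det n (A : F -> 'M[F]_n) s :
  (forall i j, derivable (fun z : F => (A z i j : F^o)) s 1) ->
  derivable (fun z : F => (\det (A z) : F^o)) s 1.
Proof.
move=> dA; rewrite (_ : (fun z => _) = \sum_(w : 'S_n)
    ((-1) ^+ w *: \prod_i (fun z => A z i (w i) : F^o))); last first.
  apply/funext => z; rewrite fct_sumE; apply: eq_bigr => w _.
  by rewrite /= fct_prodE.
elim/big_ind : _ => [|f g|w _]; [exact: derivable_cst|exact: derivableD|].
apply: derivableZ; elim/big_ind : _ => [|f g|i _] //; exact: derivableM.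
Qed.

Lemma is_mxderiveV n (A : F -> 'M[F]_n) s dA :
  A s \in unitmx -> is_mxderive A s dA ->
  is_mxderive (fun z => invmx (A z)) s (- (invmx (A s) *m dA *m invmx (A s))).
Proof.
move=> As_unit dAs.
(* By Cramer's formula the entries of the inverse are differentiable; the
   value of the derivative then follows from differentiating A A^-1 = 1. *)
have dA_entry i j : derivable (fun z : F => (A z i j : F^o)) s 1.
  exact: ex_derive.
have ddet := derivable_det dA_entry.
have det_neq0 : \det (A s) != 0 by rewrite -unitfE.
(* The determinant is continuous and nonzero at [s], hence nonzero nearby. A whole neighbourhood is
   needed because [invmx] follows Cramer's formula only on invertible matrices. *)
have A_unit : \forall z \near s, A z \in unitmx.
  have /differentiable_continuous/cvgr_neq0 :
      differentiable (fun z : F => (\det (A z) : F^o)) s.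
    exact/derivable1_diffP.
  move=> /(_ det_neq0); apply: filterS => z.
  by rewrite unitmxE unitfE.
have dinv i j : derivable (fun z : F => (invmx (A z) i j : F^o)) s 1.
  have dadj : derivable (fun z : F => ((\det (A z))^-1 * (\adj (A z)) i j : F^o)) s 1.
    apply: derivableM; first exact: derivableV.
    (* A cofactor is a signed minor, so [derivable_det] applies again. *)
    rewrite (_ : (fun z => _) = (-1) ^+ (j + i) *:
      (fun z => \det (row' j (col' i (A z))) : F^o)); last first.
      by apply/funext => z; rewrite mxE.
    apply: derivableZ; apply: derivable_det => a b.
    by rewrite (_ : (fun z => _) =
      (fun z => A z (lift j a) (lift i b) : F^o)) //; apply/funext => z; rewrite !mxE.
  apply: near_eq_derivable dadj.
  by apply: filterS A_unit => z Az; rewrite /invmx Az [RHS]mxE.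
pose dV := \matrix_(i, j) 'D_1 (fun z : F => (invmx (A z) i j : F^o)) s.
have dVs : is_mxderive (fun z => invmx (A z)) s dV.
  by move=> i j; rewrite mxE; exact/derivableP.
apply: (is_mxderive_eq dVs).
have dV_eq0 : dA *m invmx (A s) + A s *m dV = 0.
  apply/matrixP => i j; rewrite -[LHS](@derive_val _ _ _ _ _ _ _ (is_mxderiveM dAs dVs i j)).
  (* The zero is read as the derivative of an entry of the constant identity matrix, with which the
     product agrees near [s]. *)
  rewrite mxE -[RHS](@derive_cst _ _ _ ((1%:M : 'M[F]_n) i j : F^o) s 1).
  apply: near_eq_derive.
  by apply: filterS A_unit => z Az; rewrite mulmxV.
rewrite -mulmxA -mulmxN; move/eqP: dV_eq0; rewrite addrC addr_eq0 => /eqP <-.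
by rewrite mulKmx.
Qed.

Lemma is_mxderive_pencil n (M D K : 'M[F]_n) s :
  is_mxderive (pencil M D K) s ((s *+ 2) *: M + D).
Proof.
have dsqr : is_derive s 1 (fun z : F => (z ^+ 2 : F^o)) (s *+ 2).
  apply: DeriveDef; first exact: exprn_derivable.
  by rewrite exp_derive /= expr1 [LHS]mulr1 [LHS]mulr_natl.
apply: is_mxderive_eq.
  apply: is_mxderiveD; last exact: is_mxderive_cst.
  apply: is_mxderiveD; first exact: is_mxderive_scale dsqr.
  exact: is_mxderive_scale (is_derive_id _ _).
by rewrite addr0 scale1r.
Qed.

End MatrixDerivative.

Section Interpolation.
Variables (F : fieldType) (n p q : nat).
Variables (M D K : 'M[F]_n) (B : 'M[F]_(n, p)) (C1 C0 : 'M[F]_(q, n)).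

Lemma pencil_unitmx s : ~ is_pencil_root M D K s -> pencil M D K s \in unitmx.
Proof. by move=> nroot; rewrite unitmxE unitfE; apply/eqP. Qed.

(** The equation forces [x] to be the state P^-1 B l. Characterising [x] this way lets one lemma
    serve both the system and the reduced model without computing an inverse. *)
Lemma transfer_mulr m s (x : 'M[F]_(n, m)) (l : 'M[F]_(p, m)) :
  pencil M D K s \in unitmx -> pencil M D K s *m x = B *m l ->
  transfer M D K B C1 C0 s *m l = (s *: C1 + C0) *m x.
Proof. by move=> Pu eq_x; rewrite -!mulmxA -eq_x mulKmx. Qed.

Lemma transfer_mull m s (y : 'M[F]_(m, n)) (r : 'M[F]_(m, q)) :
  pencil M D K s \in unitmx -> y *m pencil M D K s = r *m (s *: C1 + C0) ->
  r *m transfer M D K B C1 C0 s = y *m B.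
Proof. by move=> Pu eq_y; rewrite !mulmxA -eq_y mulmxK. Qed.

End Interpolation.

Section TransferDerivative.
Variables (R : realType) (n p q : nat).
Variables (M D K : 'M[R[i]]_n) (B : 'M[R[i]]_(n, p)) (C1 C0 : 'M[R[i]]_(q, n)).

Lemma is_mxderive_val m k (W : R[i] -> 'M[R[i]]_(m, k)) s dW :
  is_mxderive W s dW -> mxderiv W s = dW.
Proof.
by move=> dWs; apply/matrixP => i j; rewrite mxE derive1E; case: (dWs i j).
Qed.

Lemma mxderiv_transfer s : pencil M D K s \in unitmx ->
  mxderiv (transfer M D K B C1 C0) s =
    C1 *m invmx (pencil M D K s) *m B
    - (s *: C1 + C0) *m invmx (pencil M D K s) *m ((s *+ 2) *: M + D)
      *m invmx (pencil M D K s) *m B.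
Proof.
move=> Pu; apply: is_mxderive_val; apply: is_mxderive_eq.
  apply: is_mxderiveM; last exact: is_mxderive_cst.
  apply: is_mxderiveM; last exact: (is_mxderiveV Pu (@is_mxderive_pencil _ _ M D K s)).
  apply: is_mxderiveD; last exact: is_mxderive_cst.
  exact: is_mxderive_scale (is_derive_id _ _).
by rewrite scale1r addr0 mulmx0 addr0 mulmxDl mulmxN mulNmx !mulmxA.
Qed.

(** The two outer resolvents are absorbed into [x] = P^-1 B l and [y] = r C P^-1. The resulting
    value contains no inverse, so it can be compared across models of different order. *)
Lemma mxderiv_transfer_bitangential s k m (x : 'M[R[i]]_(n, k))
    (l : 'M[R[i]]_(p, k)) (y : 'M[R[i]]_(m, n)) (r : 'M[R[i]]_(m, q)) :
  pencil M D K s \in unitmx -> pencil M D K s *m x = B *m l ->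
  y *m pencil M D K s = r *m (s *: C1 + C0) ->
  r *m mxderiv (transfer M D K B C1 C0) s *m l =
    r *m C1 *m x - y *m ((s *+ 2) *: M + D) *m x.
Proof.
move=> Pu eq_x eq_y; rewrite mxderiv_transfer // mulmxBr mulmxBl.
have -> : x = invmx (pencil M D K s) *m B *m l by rewrite -mulmxA -eq_x mulKmx.
have -> : y = r *m (s *: C1 + C0) *m invmx (pencil M D K s).
  by rewrite -eq_y mulmxK.
by rewrite !mulmxA.
Qed.

End TransferDerivative.

Theorem theorem8 (R : realType) (n p q nu : nat)
  (rM rD rK : 'M[R]_n) (rB : 'M[R]_(n, p)) (rC0 rC1 : 'M[R]_(q, n))
  (S Q : 'M[R[i]]_nu) (L : 'M[R[i]]_(p, nu)) (Rm : 'M[R[i]]_(nu, q))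
  (Pi : 'M[R[i]]_(n, nu)) (Ups : 'M[R[i]]_(nu, n))
  (si : R[i]) (vi wi : 'cV[R[i]]_nu) (li : 'cV[R[i]]_p) (rhoi : 'cV[R[i]]_q) :
  let M := complexify rM in
  let D := complexify rD in
  let K := complexify rK in
  let B := complexify rB in
  let C0 := complexify rC0 in
  let C1 := complexify rC1 in
  let W := transfer M D K B C1 C0 in
  let T := Ups *m Pi in
  let F2 := invmx T *m Ups *m M *m Pi in
  let F1 := invmx T *m Ups *m D *m Pi in
  let F0 := invmx T *m Ups *m K *m Pi in
  let G := invmx T *m Ups *m B in
  let H1 := C1 *m Pi in
  let H0 := C0 *m Pi in
  let What := transfer F2 F1 F0 G H1 H0 in
  observable L S ->
  controllable Q Rm ->
  (forall s : R[i], eigenvalue S s -> ~ is_pencil_root M D K s) ->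
  (forall s : R[i], eigenvalue Q s -> ~ is_pencil_root M D K s) ->
  M *m Pi *m (S *m S) + D *m Pi *m S + K *m Pi = B *m L ->
  (Q *m Q) *m Ups *m M + Q *m Ups *m D + Ups *m K = Rm *m C0 + Q *m Rm *m C1 ->
  T \in unitmx ->
  eigenvalue S si ->
  eigenvalue Q si ->
  simple_eigenvalue S si ->
  simple_eigenvalue Q si ->
  vi != 0 ->
  wi != 0 ->
  S *m vi = si *: vi ->
  wi^t* *m Q = si *: wi^t* ->
  li = L *m vi ->
  rhoi^t* = wi^t* *m Rm ->
  ~ is_pencil_root F2 F1 F0 si ->
  [/\ What si *m li = W si *m li,
      rhoi^t* *m What si = rhoi^t* *m W si &
      rhoi^t* *m mxderiv What si *m li = rhoi^t* *m mxderiv W si *m li].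
Proof.
move=> M D K B C0 C1 W T F2 F1 F0 G H1 H0 What _ _ regS _ eq_Pi eq_Ups Tu eigS _
  _ _ _ _ Sv wQ li_def rho_def nroot.
have Pu : pencil M D K si \in unitmx by apply/pencil_unitmx/regS.
have Fu := pencil_unitmx nroot.
(* The reduced coefficients are images of [M], [D], [K] under the linear map X -> T^-1 Ups X Pi,
   which therefore carries the pencil and its derivative along. *)
have FE : pencil F2 F1 F0 si = invmx T *m (Ups *m pencil M D K si *m Pi).
  by rewrite /pencil !(mulmxDl, mulmxDr) -!(scalemxAl, scalemxAr) !mulmxA.
have dFE : (si *+ 2) *: F2 + F1 =
    invmx T *m (Ups *m ((si *+ 2) *: M + D) *m Pi).
  by rewrite !(mulmxDl, mulmxDr) -!(scalemxAl, scalemxAr) !mulmxA.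
have HE : si *: H1 + H0 = (si *: C1 + C0) *m Pi.
  by rewrite mulmxDl scalemxAl.
have eq_x : pencil M D K si *m (Pi *m vi) = B *m li.
  (* Apply the first Sylvester equation to [vi]: each factor [S] becomes the scalar [si]. *)
  rewrite li_def mulmxA -eq_Pi /pencil !mulmxDl -!scalemxAl -!mulmxA !Sv.
  by rewrite -!scalemxAr Sv -!scalemxAr scalerA -expr2.
have eq_y : wi^t* *m Ups *m pencil M D K si = rhoi^t* *m (si *: C1 + C0).
  (* Dually, multiply the second equation by [wi^t*] on the left, where each [Q] becomes [si]. *)
  have /(congr1 (mulmx (wi^t* ))) := eq_Ups.
  rewrite rho_def /pencil !mulmxDr !mulmxA !wQ -!scalemxAl wQ -!scalemxAl.
  by rewrite scalerA -expr2 -!scalemxAr [RHS]addrC => ->.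
(* The factor [T] in the reduced costate cancels the T^-1 in every projected coefficient. *)
have TK m (X : 'M[R[i]]_(nu, m)) :
    wi^t* *m T *m (invmx T *m X) = wi^t* *m X.
  by rewrite mulmxA mulmxK.
have eq_xr : pencil F2 F1 F0 si *m vi = G *m li.
  by rewrite FE -!mulmxA eq_x.
have eq_yr : wi^t* *m T *m pencil F2 F1 F0 si = rhoi^t* *m (si *: H1 + H0).
  by rewrite FE HE TK !mulmxA eq_y.
split.
- by rewrite (transfer_mulr _ _ Fu eq_xr) (transfer_mulr _ _ Pu eq_x) HE mulmxA.
- rewrite (transfer_mull _ Fu eq_yr) (transfer_mull _ Pu eq_y).
  by rewrite /G -[invmx T *m _ *m _]mulmxA TK mulmxA.
have E1 := mxderiv_transfer_bitangential Fu eq_xr eq_yr.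
have E2 := mxderiv_transfer_bitangential Pu eq_x eq_y.
(* The costate now meets Ups P' Pi without T^-1, so both right-hand sides agree up to
   associativity. *)
rewrite dFE TK in E1.
by apply: etrans E1 (etrans _ (esym E2)); rewrite !mulmxA.
Qed.
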